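(* Let $s\in(0,1)$ and let $\{X_n\}_{n\in\mathbb{N}}$ be a Manneville-Pomeau process with parameter $s$, $X_t=\varphi(T_s^t(U_0))$, with $\varphi\in\mathcal{L}^1(\mu_s)$ an almost everywhere increasing function. Let $t_1,\dots,t_n\in\mathbb{N}$ and set $h_i:=t_i-t_1$. Then, for all $(u_1,\dots,u_n)\in I^n$, $$C_{X_{t_1},\dots,X_{t_n}}(u_1,\dots,u_n)=\left(\sum_{k=0}^{n_0-1}\Big[F_0\Big(b_{h_n,k}\big(F_0^{-1}(u_2),\dots,F_0^{-1}(u_n)\big)\Big)-F_0(a_{h_n,k})\Big]\right)\delta_{\mathbb{N}^*}(n_0)$$ $$\qquad+\min\Big\{u_1,F_0\Big(b_{h_n,n_0}\big(F_0^{-1}(u_2),\dots,F_0^{-1}(u_n)\big)\Big)\Big\}-F_0(a_{h_n,n_0}),$$ where $\delta_{\mathbb{N}^*}(x)$ equals $1$ if $x\in\mathbb{N}^*$ and $0$ otherwise; $n_0=n_0(u_1,n)$ is the index $k\in\{0,\dots,2^{h_n}-1\}$ for which $u_1\in[F_0(a_{h_n,k}),F_0(a_{h_n,k+1}))$ (with $n_0=2^{h_n}-1$ if $u_1=1$); $\{a_{h_n,k}\}_{k=0}^{2^{h_n}}$ are the end points of the nodes of $T_s^{h_n}$; and, for $(x_2,\dots,x_n)\in I^{n-1}$, $$b_{h_n,k}(x_2,\dots,x_n)=\min_{i=2,\dots,n}\{c_i(x_i;h_n,k)\},$$ with $c_i(x_i;h_n,k)=B_i(x_i;h_n,k)$,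 where $$B_i(x_i;h_n,k)=\min_{j=0,\dots,2^{h_i}-1}\big\{\mathcal{T}_{h_i,j}(x_i):\ \mathcal{T}_{h_i,j}(x_i)>a_{h_n,k}\ \text{and}\ a_{h_i,j}<a_{h_n,k+1}\big\},$$ if the set over which this minimum is taken is nonempty, and $c_i(x_i;h_n,k)=a_{h_n,k}$ if that set is empty.
   Context: $I=[0,1]$, $\mathbb{N}=\{0,1,2,\dots\}$, $\mathbb{N}^*=\mathbb{N}\setminus\{0\}$, $\lambda$ is Lebesgue measure on $I$. For $s>0$ the Manneville-Pomeau transformation $T_s:I\to I$ is $T_s(x)=x+x^{1+s}\ (\mathrm{mod}\ 1)$; $T_s^k$ is its $k$-fold composition. For $s\in(0,1)$, $\mu_s$ denotes the $T_s$-invariant Borel probability measure on $I$ that is absolutely continuous with respect to $\lambda$; it is ergodic and has a positive density, so $F_0(x):=\mu_s([0,x])$ is a continuous, strictly increasing bijection of $I$. $U_0$ is a random variable with law $\mu_s$ (so $F_0$ is its distribution function), and for $\varphi:I\to\mathbb{R}$ in $\mathcal{L}^1(\mu_s)$ the process $X_t=\varphi(T_s^t(U_0))$, $t\in\mathbb{N}$, is a Manneville-Pomeau (MP) process with parameter $s$. ''Almost everywhere'' refers to Lebesgue measure. $C_{X_{t_1},\dots,X_{t_n}}$ denotes the copula of the random vector $(X_{t_1},\dots,X_{t_n})$. For a positive integer $h$, $T_s^h$ has $2^h$ parts (branches), on each of which it is continuous, increasing and one-to-one; $0=a_{h,0}<a_{h,1}<\dots<a_{h,2^h}=1$ are the end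 points of these parts, and $[a_{h,k},a_{h,k+1})$ is called the $k$-th node of $T_s^h$, $k=0,\dots,2^h-1$. $\mathcal{T}_{h,k}:I\to[a_{h,k},a_{h,k+1}]$ is the inverse of $T_s^h$ restricted to its $k$-th node (with $\mathcal{T}_{h,k}(0)=a_{h,k}$ and $\mathcal{T}_{h,k}(1)=a_{h,k+1}$).
   Formalization: The times are assumed to satisfy t_1 ≤ t_i ≤ t_n for all i (otherwise T_s^{h_i} is undefined or the formula fails), n ≥ 2, and ''almost everywhere increasing'' means strictly increasing off a Lebesgue-null set. *)

(* Defs.v *)
From HB Require Import structures.
From mathcomp Require Import all_boot all_order all_algebra.
From mathcomp Require Import all_classical all_reals all_analysis.

Set Implicit Arguments.
Unset Strict Implicit.
Unset Printing Implicit Defensive.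

Import Order.TTheory GRing.Theory Num.Theory.
Import numFieldNormedType.Exports.

Local Open Scope classical_set_scope.
Local Open Scope ring_scope.

(* The interval I = [0,1] is the subset `[0, 1] of the real line: measures on I
   are measures on R that give I full mass, and functions on I are functions on
   R whose values outside I are irrelevant. *)

Definition mp_map {R : realType} (s x : R) : R :=
  let y := x + x `^ (1 + s) in y - (Num.floor y)%:~R.

(* For 0 < s < 1 these three conditions determine mu: it is the measure mu_s. *)
Definition mp_measure {R : realType} (s : R)
    (mu : probability (measurableTypeR R) R) : Prop :=
  [/\ mu `[0, 1]%classic = 1%E,
      (forall A : set (measurableTypeR R), measurable A ->
         mu (`[0, 1] `&` (mp_map s @^-1` A)) = mu A) &
      mu `<< @lebesgue_measure R].

Definition F0 {R : realType} (mu : probability (measurableTypeR R) R) (x : R) :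
  R := fine (mu `[0, x]%classic).

(* Library inverse of F0 : I -> I; 0 is only the junk value for u outside the
   range. *)
Definition F0_inv {R : realType} (mu : probability (measurableTypeR R) R) :
  R -> R := 'pinv_(fun=> 0) `[0, 1] (F0 mu).

(* Strictly increasing off a Lebesgue-null subset of I. *)
Definition ae_increasing {R : realType} (phi : R -> R) : Prop :=
  exists N : set (measurableTypeR R), (@lebesgue_measure R).-negligible N /\
    forall x y, (`[0, 1] `\` N) x -> (`[0, 1] `\` N) y ->
      x < y -> phi x < phi y.

Definition mp_process {R : realType} (s : R)
    (mu : probability (measurableTypeR R) R) (phi : R -> R)
    (d : measure_display) (Omega : measurableType d) (P : probability Omega R)
    (U0 : {RV P >-> R}) (X : nat -> {RV P >-> R}) : Prop :=
  [/\ mp_measure s mu,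
      (forall A : set (measurableTypeR R), measurable A ->
         distribution P U0 A = mu A),
      mu.-integrable `[0, 1] (EFin \o phi) &
      forall t w, X t w = phi (iter t (mp_map s) (U0 w))].

(* Grounded, with uniform margins, and n-increasing: every box [a, b] in I^n
   has nonnegative C-volume, the vertex indexed by S taking the lower end point
   in the coordinates of S. *)
Definition is_copula {R : realType} (n : nat) (C : ('I_n -> R) -> R) : Prop :=
  [/\ (forall u i, (forall j, 0 <= u j <= 1) -> u i = 0 -> C u = 0),
      (forall u i, (forall j, 0 <= u j <= 1) ->
         (forall j, j != i -> u j = 1) -> C u = u i) &
      (forall a b, (forall j, [&& 0 <= a j, a j <= b j & b j <= 1]) ->
         0 <= \sum_(S : {set 'I_n})
                (-1) ^+ #|S| * C (fun j => if j \in S then a j else b j))].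

(* Sklar's relation between the joint and the marginal distribution functions.
   When the latter are continuous it determines C on I^n. *)
Definition copula_of {R : realType} (d : measure_display)
    (Omega : measurableType d) (P : probability Omega R) (n : nat)
    (Y : 'I_n -> {RV P >-> R}) (C : ('I_n -> R) -> R) : Prop :=
  is_copula C /\
  forall y : 'I_n -> R,
    fine (P [set w | forall i, Y i w <= y i]) =
      C (fun i => fine (cdf (Y i) (y i))).

(* a 0 < ... < a (2 ^ h) are the end points of the nodes of the h-th iterate.
   For h = 0 the only node of the identity is [0, 1). *)
Definition node_endpoints {R : realType} (s : R) (h : nat) (a : nat -> R) :
    Prop :=
  let f := iter h (mp_map s) in
  [/\ a 0%N = 0, a (2 ^ h)%N = 1 &
      forall k, (k < 2 ^ h)%N ->
        [/\ a k < a k.+1,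
            {within `[a k, a k.+1[, continuous f},
            {in `[a k, a k.+1[ &, {homo f : x y / x < y}} &
            set_bij `[a k, a k.+1[ `[0, 1[ f]].

(* The inverse branch I -> [a_k, a_{k+1}]; the node is mapped onto [0, 1), and
   the branch is extended by continuity at 1. *)
Definition inv_branch {R : realType} (s : R) (h : nat) (a : nat -> R) (k : nat)
    (y : R) : R :=
  if y == 1 then a k.+1
  else 'pinv_(fun=> 0) `[a k, a k.+1[ (iter h (mp_map s)) y.

(* The family of end points a is indexed by the iterate and the node.  The index
   set 'I_n.+2 stands for {1, ..., n+2}: ord0 is the first time and ord_max the
   last one. *)

Definition n0 {R : realType} (mu : probability (measurableTypeR R) R)
    (h : nat) (a : nat -> R) (u : R) : nat :=
  if u == 1 then (2 ^ h).-1
  else if [pick k : 'I_(2 ^ h) | F0 mu (a k) <= u < F0 mu (a k.+1)] is Some k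
       then k else 0%N.

Definition c_fun {R : realType} (s : R) (a : nat -> nat -> R)
    (hi hn k : nat) (x : R) : R :=
  let T (j : 'I_(2 ^ hi)) := inv_branch s hi (a hi) j x in
  let in_set j := (a hn k < T j) && (a hi j < a hn k.+1) in
  if [pick j | in_set j] is Some j0
  then \big[Num.min/T j0]_(j | in_set j) T j
  else a hn k.

(* The initial value of the minimum is its own last term. *)
Definition b_fun {R : realType} (s : R) (a : nat -> nat -> R) (n : nat)
    (h : 'I_n.+2 -> nat) (k : nat) (x : 'I_n.+2 -> R) : R :=
  let c i := c_fun s a (h i) (h ord_max) k (x i) in
  \big[Num.min/c ord_max]_(i : 'I_n.+2 | i != ord0) c i.

(* Main.v *)
Require Import Defs.
From HB Require Import structures.
From mathcomp Require Import all_boot all_order all_algebra.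
From mathcomp Require Import all_classical all_reals all_analysis.
From mathcomp Require Import measurable_realfun lra.

Set Implicit Arguments.
Unset Strict Implicit.
Unset Printing Implicit Defensive.

Import Order.TTheory GRing.Theory Num.Theory.
Import numFieldNormedType.Exports.

Local Open Scope classical_set_scope.
Local Open Scope ring_scope.

(** The copula is first identified with an orbit probability.  Off a null set
    [phi] is strictly increasing, so every sublevel set of [phi] at a suitable
    level is, up to a null set, the ray ending at a prescribed x in (0, 1)
    ([level_set_ray]).  Choosing levels that correspond to [F0_inv (u i)],
    invariance of [mu] makes the i-th marginal value equal to [u i], and Sklar's
    relation gives, for u inside the open cube,
      C u = mu {z | forall i, T^(t i) z <= F0_inv (u i)}.
    When [phi] is unbounded no finite level has marginal value 1, so the faces
    u i = 1 are reached by a limit: both sides are 1-Lipschitz in each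
    coordinate ([copula_lipschitz], [copula_law_lipschitz]).  On the faces
    u i = 0 both sides vanish.  By invariance the times t i may then be replaced
    by h i = t i - t ord0 ([copula_law_shift]).

    It remains to compute the mass of the set of x <= F0_inv (u ord0) with
    T^(h i) x <= y i for the later indices i, where y i = F0_inv (u i).  The
    end points of the nodes of T^h are its zeros in [0, 1), and T 0 = 0, hence
    for h i <= hn a node of T^hn is contained in a single node of T^(h i)
    ([node_nested]).  On that larger node T^(h i) is increasing, so
    T^(h i) x <= y i means that x is at most the value at y i of one inverse
    branch ([le_inv_branch]), and the minimum defining c_i ranges over at most
    this one value ([c_funE]).  Thus on the k-th node the later conditions cut
    out the points up to b_k ([le_b_fun]), a set of mass F0 (b_k) - F0 (a_k).
    Adding the nodes from left to right up to the one which contains the first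
    coordinate gives the formula ([mass_in_node], [mass_formula]). *)

(** * Copulas are Lipschitz *)

Definition update {T : eqType} {S : Type} (w : T -> S) (i : T) (x : S) : T -> S :=
  fun j => if j == i then x else w j.

Section Copula.
Variables (R : realType) (n : nat) (C : ('I_n -> R) -> R).
Hypothesis copC : is_copula C.

Let in_cube (w : 'I_n -> R) := forall i, 0 <= w i <= 1.

Lemma update_in_cube w i x : in_cube w -> 0 <= x <= 1 ->
  in_cube (update w i x).
Proof. by move=> wI xI j; rewrite /update; case: ifP. Qed.

(** The difference is the volume of the box with sides [0, w j] for j <> i and
    [x, w i]: the vertices that use a lower end point 0 contribute nothing,
    since C is grounded. *)
Lemma copula_mono w i x : in_cube w -> 0 <= x <= w i -> C (update w i x) <= C w.
Proof.
move=> wI /andP[x0 xw]; have [grd _ inc] := copC.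
pose a0 j : R := if j == i then x else 0.
have /inc : forall j, [&& 0 <= a0 j, a0 j <= w j & w j <= 1].
  move=> j; have /andP[w0 w1] := wI j; rewrite /a0 w1 andbT.
  by case: eqP => [->|_]; rewrite ?x0 ?xw ?lexx ?w0.
rewrite (bigD1 finset.set0)//= (bigD1 [set i]%SET)/=; last first.
  by apply/eqP => /setP/(_ i); rewrite !inE eqxx.
rewrite cards0 cards1 expr0 expr1 mul1r mulN1r big1 => [|S /andP[S0 Si]].
  have -> : (fun j => if j \in finset.set0 then a0 j else w j) = w.
    by apply/funext => j; rewrite inE.
  have -> : (fun j => if j \in [set i]%SET then a0 j else w j) = update w i x.
    by apply/funext => j; rewrite inE /a0 /update; case: eqP.
  by rewrite addr0 subr_ge0.
suff [j jS ji] : exists2 j, j \in S & j != i.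
  rewrite (grd _ j) ?mulr0//; last by rewrite jS /a0 (negbTE ji).
  move=> l; rewrite /a0; case: ifP => // _; case: eqP => _.
    by rewrite x0 (le_trans xw)//; case/andP: (wI i).
  by rewrite lexx ler01.
have /finset.set0Pn[j jS] := S0.
have [ji|] := eqVneq j i; last by exists j.
move: jS; rewrite ji => iS; apply: contrapT => noj; case/negP: Si.
apply/eqP/setP => l; rewrite inE; apply/idP/idP => [lS|/eqP->//].
by apply/negPn/negP => li; apply: noj; exists l.
Qed.

(** The same computation with lower end points x and y in two coordinates; four
    vertices survive.  Read as: the increment of C in coordinate i does not decrease when
    coordinate j is raised. *)
Lemma copula_2increasing w i j x y : in_cube w -> i != j ->
    0 <= x <= w i -> 0 <= y <= w j ->
  C (update w j y) - C (update (update w j y) i x) <=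
  C w - C (update w i x).
Proof.
move=> wI ij /andP[x0 xw] /andP[y0 yw]; have [grd _ inc] := copC.
pose a0 l : R := if l == i then x else if l == j then y else 0.
have a0w l : [&& 0 <= a0 l, a0 l <= w l & w l <= 1].
  have /andP[w0 w1] := wI l; rewrite /a0 w1 andbT.
  case: eqP => [->|_]; first by rewrite x0 xw.
  by case: eqP => [->|_]; rewrite ?y0 ?yw ?lexx ?w0.
have := inc _ _ a0w.
rewrite (bigD1 finset.set0)//= (bigD1 [set i]%SET)/=; last first.
  by apply/eqP => /setP/(_ i); rewrite !inE eqxx.
rewrite (bigD1 [set j]%SET)/=; last first.
  apply/andP; split; apply/eqP => /setP/(_ j); rewrite !inE eqxx//.
  by rewrite eq_sym (negbTE ij).
rewrite (bigD1 [set i; j]%SET)/=; last first.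
  apply/andP; split; first (apply/andP; split).
  - by apply/eqP => /setP/(_ j); rewrite !inE eqxx orbT.
  - apply/eqP => /setP/(_ j); rewrite !inE eqxx orbT.
    by rewrite eq_sym (negbTE ij).
  - by apply/eqP => /setP/(_ i); rewrite !inE eqxx (negbTE ij).
rewrite cards0 !cards1 cards2 ij expr0 expr1 mul1r !mulN1r big1; last first.
  move=> S /andP[/andP[/andP[S0 Si] Sj] Sij].
  suff [l lS /andP[li lj]] : exists2 l, l \in S & (l != i) && (l != j).
    rewrite (grd _ l) ?mulr0//; last by rewrite lS /a0 (negbTE li) (negbTE lj).
    move=> m; have /and3P[p q r] := a0w m.
    by case: ifP => // _; rewrite p (le_trans q).
  apply: contrapT => nol.
  have Sin l : l \in S -> (l == i) || (l == j).
    move=> lS; apply/negPn/negP; rewrite negb_or => lij; apply: nol.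
    by exists l.
  have [iS|iS] := boolP (i \in S); have [jS|jS] := boolP (j \in S).
  - case/eqP: Sij; apply/setP => l; rewrite !inE; apply/idP/idP; first exact: Sin.
    by case/orP => /eqP->.
  - case/eqP: Si; apply/setP => l; rewrite !inE; apply/idP/idP => [lS|/eqP->//].
    by case/orP: (Sin l lS) => // /eqP lj; rewrite lj (negbTE jS) in lS.
  - case/eqP: Sj; apply/setP => l; rewrite !inE; apply/idP/idP => [lS|/eqP->//].
    by case/orP: (Sin l lS) => // /eqP li; rewrite li (negbTE iS) in lS.
  - case/eqP: S0; apply/setP => l; rewrite !inE; apply/negP => lS.
    by case/orP: (Sin l lS) => /eqP le; move: lS; rewrite le ?(negbTE iS) ?(negbTE jS).
rewrite sqrrN expr1n mul1r addr0.
have -> : (fun l => if l \in finset.set0 then a0 l else w l) = w.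
  by apply/funext => l; rewrite inE.
have -> : (fun l => if l \in [set i]%SET then a0 l else w l) = update w i x.
  by apply/funext => l; rewrite inE /a0 /update; case: eqP.
have -> : (fun l => if l \in [set j]%SET then a0 l else w l) = update w j y.
  apply/funext => l; rewrite inE /a0 /update; case: eqP => // ->.
  by rewrite eq_sym (negbTE ij).
have -> : (fun l => if l \in [set i; j]%SET then a0 l else w l) =
    update (update w j y) i x.
  apply/funext => l; rewrite !inE /a0 /update.
  by case: (l == i); case: (l == j).
lra.
Qed.

(** Raising all the other coordinates to 1 only increases the increment in
    coordinate i, and there the uniform margin evaluates it. *)
Lemma copula_lip1 w i x : in_cube w -> 0 <= x <= w i ->
  C w - C (update w i x) <= w i - x.
Proof.
move=> wI xw; have [_ mrg _] := copC.
pose raise (s : seq 'I_n) := foldr (fun j v => update v j 1) w s.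
have raiseE s l : raise s l = if l \in s then 1 else w l.
  by elim: s => //= j s IH; rewrite /update inE IH; case: eqP.
have raiseI s : in_cube (raise s).
  by move=> l; rewrite raiseE; case: ifP; rewrite ?ler01 ?lexx.
have step s : i \notin s ->
  C w - C (update w i x) <= C (raise s) - C (update (raise s) i x).
  elim: s => [//|j s IH]; rewrite inE negb_or => /andP[ij iS].
  apply: (le_trans (IH iS)).
  have /andP[s0 s1] := raiseI s j.
  have r1 : raise (j :: s) j = 1 by rewrite raiseE inE eqxx.
  have ri : raise (j :: s) i = w i.
    by rewrite raiseE inE (negbTE ij) (negbTE iS).
  have := @copula_2increasing (raise (j :: s)) i j x (raise s j) (raiseI _) ij.
  rewrite ri r1 s0 s1 => /(_ xw isT).
  suff -> : update (raise (j :: s)) j (raise s j) = raise s by [].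
  by apply/funext => l /=; rewrite /update; case: eqP => // ->.
pose s := [seq j <- enum 'I_n | j != i].
have is_s : i \notin s by rewrite mem_filter eqxx.
have /andP[w0 w1] := wI i; have /andP[x0 xwi] := xw.
have rE j : j != i -> raise s j = 1.
  by move=> ji; rewrite raiseE mem_filter ji mem_enum.
have ri : raise s i = w i by rewrite raiseE (negbTE is_s).
apply: (le_trans (step _ is_s)).
rewrite (mrg _ i (raiseI s) rE) ri (mrg _ i).
- by rewrite /update eqxx.
- by apply: update_in_cube => //; rewrite x0 (le_trans xwi).
- by move=> j ji; rewrite /update (negbTE ji) rE.
Qed.

(** The coordinates are lowered from w to v one at a time. *)
Lemma copula_lipschitz w v : in_cube w -> (forall i, 0 <= v i <= w i) ->
  0 <= C w - C v <= \sum_i (w i - v i).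
Proof.
move=> wI vw.
pose lower (s : seq 'I_n) := foldr (fun j z => update z j (v j)) w s.
have lowerE s l : lower s l = if l \in s then v l else w l.
  by elim: s => //= j s IH; rewrite /update inE IH; case: eqP => [->|].
have lowerI s : in_cube (lower s).
  move=> l; rewrite lowerE; case: ifP => // _.
  have /andP[v0 vl] := vw l; have /andP[_ w1] := wI l.
  by rewrite v0 (le_trans vl).
have step s : uniq s ->
  0 <= C w - C (lower s) <= \sum_(i <- s) (w i - v i).
  elim: s => [_|j s IH /= /andP[js us]]; first by rewrite big_nil subrr lexx.
  rewrite big_cons; have /andP[IH0 IH1] := IH us.
  have vlj : 0 <= v j <= lower s j by rewrite lowerE (negbTE js).
  have m := copula_mono (lowerI s) vlj.
  have lip := copula_lip1 (lowerI s) vlj.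
  rewrite [lower s j]lowerE (negbTE js) in lip.
  apply/andP; split; lra.
have low_v : lower (enum 'I_n) = v.
  by apply/funext => l; rewrite lowerE mem_enum.
by have := step _ (enum_uniq 'I_n); rewrite low_v big_enum.
Qed.

End Copula.

Lemma eq_measure_ae d (T : measurableType d) (R : realType)
    (mu : {measure set T -> \bar R}) (A B N : set T) :
  measurable A -> measurable B -> measurable N -> mu N = 0%E ->
  (forall x, ~ N x -> A x <-> B x) -> mu A = mu B.
Proof.
move=> mA mB mN N0 AB.
rewrite -(measureU0 mA mN N0) -(measureU0 mB mN N0); congr (mu _).
apply/seteqP; split=> x; (have [Nx|Nx] := pselect (N x); first by right).
- by case=> // Ax; left; apply/AB.
- by case=> // Bx; left; apply/AB.
Qed.

(** * The invariant measure and its distribution function *)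

Section InvariantMeasure.
Variables (R : realType) (s : R) (mu : probability (measurableTypeR R) R).
Hypothesis mu_mp : mp_measure s mu.

Let T := @mp_map R s.
Let F := F0 mu.

Lemma lebesgue_null_mu (N : set (measurableTypeR R)) : measurable N ->
  @lebesgue_measure R N = 0%E -> mu N = 0%E.
Proof.
move=> mN N0; have [_ _ ac] := mu_mp.
by apply: (ac N) => // A mA AN; exact: (subset_measure0 mA mN AN N0).
Qed.

Lemma mu_atomless (x : measurableTypeR R) : mu [set x] = 0%E.
Proof.
by apply: lebesgue_null_mu; [exact: measurable_set1|exact: lebesgue_measure_set1].
Qed.

Lemma mu_eq_off_point (A B : set (measurableTypeR R)) x :
  measurable A -> measurable B -> (forall y, y <> x -> A y <-> B y) ->
  mu A = mu B.
Proof.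
move=> mA mB AB; apply: (eq_measure_ae (N := [set x])) => //.
exact: mu_atomless.
Qed.

Lemma mu_outside : mu (~` `[0, 1]%classic) = 0%E.
Proof.
have [mu01 _ _] := mu_mp.
by rewrite probability_setC ?mu01 ?subee//; exact: measurable_itv.
Qed.

Lemma measurable_mp_map : measurable_fun [set: measurableTypeR R] T.
Proof.
have mg : measurable_fun [set: measurableTypeR R] (fun x : R => x + x `^ (1 + s)).
  by apply: measurable_funD => //; exact: measurable_powR.
have mf : measurable_fun [set: R] (fun y : R => (Num.floor y)%:~R : R).
  by apply: nondecreasing_measurable => // x y xy; rewrite ler_int le_floor.
apply: measurable_funB => //.
by apply: (measurableT_comp mf mg).
Qed.

Lemma measurable_iter_mp_map t : measurable_fun [set: measurableTypeR R] (iter t T).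
Proof.
elim: t => [|t IH]; first exact: measurable_id.
exact: (measurableT_comp measurable_mp_map IH).
Qed.

Lemma measurable_iter_preimage t (A : set (measurableTypeR R)) : measurable A ->
  measurable (iter t T @^-1` A).
Proof.
by move=> mA; rewrite -[X in measurable X]setTI; exact: measurable_iter_mp_map.
Qed.

Lemma mu_iter t (A : set (measurableTypeR R)) : measurable A ->
  mu (iter t T @^-1` A) = mu A.
Proof.
have [_ inv _] := mu_mp.
elim: t A => [//|t IH] A mA.
have mA1 := measurable_iter_preimage 1 mA.
have -> : iter t.+1 T @^-1` A = iter t T @^-1` (T @^-1` A) by [].
rewrite IH// -[RHS]inv//.
apply: (eq_measure_ae (mu := mu) (N := ~` `[0, 1]%classic)) => //.
- by apply: measurableI => //; exact: measurable_itv.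
- by apply: measurableC; exact: measurable_itv.
- exact: mu_outside.
- by move=> x /contrapT x01; split=> [?|[]].
Qed.

Lemma mu_rayE x : mu `]-oo, x]%classic = (F x)%:E.
Proof.
rewrite /F /F0 fineK ?fin_num_measure//.
apply: (eq_measure_ae (mu := mu) (N := ~` `[0, 1]%classic)) => //; try exact: measurable_itv.
- by apply: measurableC; exact: measurable_itv.
- exact: mu_outside.
- move=> y /contrapT; rewrite /= !in_itv/= => /andP[y0 y1].
  by rewrite y0.
Qed.

Lemma F0_le x y : x <= y -> F x <= F y.
Proof.
move=> xy; rewrite -lee_fin -!mu_rayE le_measure ?inE//; try exact: measurable_itv.
by move=> z /=; rewrite !in_itv/= => /le_trans; apply.
Qed.

Lemma mu_itvE x y : x <= y -> mu `]x, y]%classic = (F y - F x)%:E.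
Proof.
move=> xy; have -> : `]x, y]%classic = `]-oo, y]%classic `\` `]-oo, x]%classic.
  apply/seteqP; split=> z; rewrite /= !in_itv/=.
    by move=> /andP[xz ->]; split=> //; apply/negP; rewrite -ltNge.
  by move=> [-> /negP]; rewrite -ltNge => ->.
rewrite measureD; try exact: measurable_itv.
  rewrite setIidr ?EFinB -?mu_rayE// => z /=; rewrite !in_itv/= => /le_trans; exact.
by rewrite -ge0_fin_numE ?fin_num_measure.
Qed.

Lemma F0_0 : F 0 = 0.
Proof. by rewrite /F /F0 set_itv1 mu_atomless. Qed.

Lemma F0_1 : F 1 = 1.
Proof. by have [mu01 _ _] := mu_mp; rewrite /F /F0 mu01. Qed.

Lemma mu_bigcup_le (A : nat -> set (measurableTypeR R)) c :
  (forall n, measurable (A n)) -> nondecreasing_seq A ->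
  (forall n, (mu (A n) <= c)%E) -> (mu (\bigcup_n A n) <= c)%E.
Proof.
move=> mA ndA Ac.
have cA := @nondecreasing_cvg_mu _ _ _ mu A mA (bigcup_measurable (fun n _ => mA n)) ndA.
rewrite -(cvg_lim _ cA)//; apply: lime_le; first by apply/cvg_ex; eexists; exact: cA.
by apply: nearW.
Qed.

(** The supremum x of the points where F0 <= u is a preimage of u.  Because mu
    has no atoms, [0, x] and ]x, 1] may be exhausted from inside by [0, x - 1/n]
    and [x + 1/n, 1], on which the two inequalities are known. *)
Lemma F0_surj u : 0 <= u <= 1 -> exists2 x, 0 <= x <= 1 & F x = u.
Proof.
move=> /andP[u0 u1].
pose S := [set y | 0 <= y <= 1 /\ F y <= u].
have S0 : S 0 by rewrite /S /= lexx ler01 F0_0.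
have ubS : ubound S 1 by move=> y [/andP[]].
have supS : has_sup S by split; [exists 0|exists 1].
pose x := sup S.
have x01 : 0 <= x <= 1.
  by rewrite (ub_le_sup _ S0) ?ge_sup//; [exists 0|exists 1].
exists x => //.
have FE z : mu `[0, z]%classic = (F z)%:E.
  by rewrite /F /F0 fineK ?fin_num_measure.
apply/eqP; rewrite eq_le; apply/andP; split.
  rewrite -lee_fin -FE.
  have -> : mu `[0, x]%classic = mu `[0, x[%classic.
    apply: (@mu_eq_off_point _ _ x); try exact: measurable_itv.
    move=> y yx; rewrite /= !in_itv/= [y <= x]le_eqVlt.
    by rewrite (_ : y == x = false)//; apply/eqP.
  rewrite itv_bnd_open_bigcup; apply: mu_bigcup_le => [n|m n mn|n].
  - exact: measurable_itv.
  - apply/subsetPset => z /=; rewrite !in_itv/= => /andP[-> /le_trans]; apply.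
    by rewrite lerB// lef_pV2 ?posrE ?ler_nat.
  - rewrite FE lee_fin.
    have xn : x - n.+1%:R^-1 < sup S by rewrite ltrBlDr ltrDl invr_gt0.
    have [y [_ Fy] xy] := sup_gt (ex_intro _ _ S0) xn.
    by rewrite (le_trans _ Fy)// F0_le// ltW.
have /andP[x0 x1] := x01.
suff : (mu `]x, 1%R]%classic <= (1 - u)%:E)%E.
  by rewrite mu_itvE// F0_1 lee_fin lerD2l lerN2.
rewrite itv_open_bnd_bigcup; apply: mu_bigcup_le => [n|m n mn|n].
- exact: measurable_itv.
- apply/subsetPset => z /=; rewrite !in_itv/= => /andP[+ ->]; rewrite andbT => xz.
  by rewrite (le_trans _ xz)// lerD2l lef_pV2 ?posrE ?ler_nat.
- set z := x + _; have xz : x < z by rewrite ltrDl invr_gt0.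
  have [z1|z1] := leP z 1; last first.
    by rewrite set_itv_ge ?measure0 ?lee_fin ?subr_ge0// bnd_simp -ltNge.
  have -> : mu `[z, 1%R]%classic = mu `]z, 1%R]%classic.
    apply: (@mu_eq_off_point _ _ z); try exact: measurable_itv.
    move=> y yz; rewrite /= !in_itv/= [z <= y]le_eqVlt.
    by rewrite (_ : z == y = false)//; apply/eqP => zy; exact: yz.
  rewrite mu_itvE// F0_1 lee_fin lerD2l lerN2 leNgt; apply/negP => /ltW Fz.
  have : z <= x.
    apply: ub_le_sup; first by exists 1.
    by split=> //; rewrite z1 (le_trans x0)// ltW.
  by rewrite leNgt xz.
Qed.

Lemma F0_invK u : 0 <= u <= 1 -> 0 <= F0_inv mu u <= 1 /\ F (F0_inv mu u) = u.
Proof.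
move=> u01; have sur : set_surj `[0, 1]%classic `[0, 1]%classic F.
  move=> v; rewrite /= in_itv/= => /F0_surj[x x01 Fx].
  by exists x => //; rewrite /= in_itv.
have uI : `[0, 1]%classic u by rewrite /= in_itv.
split; last by apply: (surjpK _ sur); rewrite inE.
have : `[0, 1]%classic (F0_inv mu u).
  by apply: (surjpinv_image_sub sur); exists u.
by rewrite /= in_itv.
Qed.

End InvariantMeasure.

(** * Nodes of the iterates *)

Lemma step_search (R : realType) (v : nat -> R) m x :
  v 0%N <= x -> x < v m -> exists2 k, (k < m)%N & v k <= x < v k.+1.
Proof.
move=> v0; elim: m => [|m IH] xm; first by move: xm; rewrite ltNge v0.
have [xv|vx] := ltP x (v m).
  by have [k km kx] := IH xv; exists k => //; exact: ltnW.
by exists m => //; rewrite vx xm.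
Qed.

Section Nodes.
Variables (R : realType) (s : R) (a : nat -> nat -> R).
Hypothesis ha : forall h, node_endpoints s h (a h).

Let T := @mp_map R s.

Lemma endpoint_ltS h k : (k < 2 ^ h)%N -> a h k < a h k.+1.
Proof. by move=> kh; have [_ _ /(_ k kh)[]] := ha h. Qed.

Lemma endpoint_le h i j : (i <= j <= 2 ^ h)%N -> a h i <= a h j.
Proof.
move=> /andP[]; elim: j => [|j IH]; first by rewrite leqn0 => /eqP->.
rewrite leq_eqVlt => /predU1P[->//|ij] jh.
by rewrite (le_trans (IH _ (ltnW jh)))// ltW// endpoint_ltS.
Qed.

Lemma endpoint_itv h k : (k <= 2 ^ h)%N -> 0 <= a h k <= 1.
Proof.
have [a0 a1 _] := ha h => kh.
by rewrite -{1}a0 -{1}a1 !endpoint_le// ?kh ?leqnn.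
Qed.

Lemma node_sub01 h k x : (k < 2 ^ h)%N -> a h k <= x < a h k.+1 -> 0 <= x < 1.
Proof.
move=> kh /andP[ax xa].
have /andP[a0 _] := endpoint_itv (ltnW kh); have /andP[_ a1] := endpoint_itv kh.
by rewrite (le_trans a0) // (lt_le_trans xa).
Qed.

Lemma node_exists h x : 0 <= x < 1 ->
  exists2 k, (k < 2 ^ h)%N & a h k <= x < a h k.+1.
Proof.
have [a0 a1 _] := ha h => /andP[x0 x1].
by apply: step_search; rewrite ?a0 ?a1.
Qed.

Lemma iter_node_itv h k x : (k < 2 ^ h)%N -> a h k <= x < a h k.+1 ->
  0 <= iter h T x < 1.
Proof.
move=> kh xk; have [_ _ /(_ k kh)[_ _ _ [fI _ _]]] := ha h.
have : `[0, 1[%classic (iter h T x) by apply: fI; rewrite /= in_itv.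
by rewrite /= in_itv.
Qed.

Lemma iter_node_lt h k : (k < 2 ^ h)%N ->
  {in `[a h k, a h k.+1[ &, {mono iter h T : x y / x < y}}.
Proof.
by move=> kh; have [_ _ /(_ k kh)[_ _ inc _]] := ha h; exact/leW_mono_in/le_mono_in.
Qed.

Lemma iter_node_surj h k y : (k < 2 ^ h)%N -> 0 <= y < 1 ->
  let z := 'pinv_(fun=> 0) `[a h k, a h k.+1[ (iter h T) y in
  a h k <= z < a h k.+1 /\ iter h T z = y.
Proof.
move=> kh y01 z; have [_ _ /(_ k kh)[_ _ _ [_ _ sur]]] := ha h.
have yI : `[0, 1[%classic y by rewrite /= in_itv.
split; last by apply: (surjpK _ sur); rewrite inE.
have : `[a h k, a h k.+1[%classic z.
  by apply: (surjpinv_image_sub sur); exists y.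
by rewrite /= in_itv.
Qed.

(** The node is mapped increasingly onto [0, 1), which has a least element. *)
Lemma iter_endpoint h k : (k < 2 ^ h)%N -> iter h T (a h k) = 0.
Proof.
move=> kh.
have [] := iter_node_surj (y := 0) kh; rewrite ?lexx ?ltr01//.
set z := 'pinv_ _ _ _ _ => zk z0.
have ak : a h k <= a h k < a h k.+1 by rewrite lexx endpoint_ltS.
apply/eqP; rewrite -z0; have := iter_node_itv kh ak; rewrite -{1}z0 => /andP[].
rewrite le_eqVlt eq_sym => /orP[//|]; rewrite (iter_node_lt kh) ?in_itv//= => za.
by case/andP: zk; rewrite leNgt za.
Qed.

Lemma iter_interior_gt0 h k x : (k < 2 ^ h)%N -> a h k < x < a h k.+1 ->
  0 < iter h T x.
Proof.
move=> kh /andP[ax xa]; rewrite -(iter_endpoint kh) (iter_node_lt kh) ?in_itv//=.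
  by rewrite lexx endpoint_ltS.
by rewrite (ltW ax).
Qed.

(** An end point of T^h that is interior to a node of T^h' would be a zero of
    T^h, hence of T^h', whereas T^h' vanishes only at the left end point of each
    of its nodes. *)
Lemma node_nested h h' k : (h <= h')%N -> (k < 2 ^ h')%N ->
  exists2 j, (j < 2 ^ h)%N & a h j <= a h' k /\ a h' k.+1 <= a h j.+1.
Proof.
move=> hh kh.
have ak : a h' k <= a h' k < a h' k.+1 by rewrite lexx endpoint_ltS.
have [j jh /andP[ja aj]] := node_exists h (node_sub01 kh ak).
exists j => //; split=> //; rewrite leNgt; apply/negP => aS.
have := iter_interior_gt0 kh (introT andP (conj aj aS)).
suff -> : iter h' T (a h j.+1) = 0 by rewrite ltxx.
have T0 m : iter m T 0 = 0.
  by have [a0 _ _] := ha m; rewrite -{1}a0 iter_endpoint// expn_gt0.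
rewrite -(subnK hh) iterD iter_endpoint ?T0//.
rewrite ltn_neqAle jh andbT; apply/eqP => jE.
have [_ a1 _] := ha h; move: aS; rewrite jE a1 ltNge.
by have /andP[_ ->] := endpoint_itv kh.
Qed.

Lemma inv_branch_itv h k y : (k < 2 ^ h)%N -> 0 <= y <= 1 ->
  a h k <= inv_branch s h (a h) k y <= a h k.+1.
Proof.
move=> kh /andP[y0 y1]; rewrite /inv_branch; case: eqP => [_|/eqP yn1].
  by rewrite lexx ltW// endpoint_ltS.
have [|/andP[-> /ltW->] _//] := @iter_node_surj h k y kh.
by rewrite y0 lt_neqAle yn1.
Qed.

(** For y = 1 both sides hold: the branch takes the value a_{k+1}, and T^h < 1 on
    the node. *)
Lemma le_inv_branch h k x y : (k < 2 ^ h)%N -> a h k <= x < a h k.+1 ->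
  0 <= y <= 1 -> (x <= inv_branch s h (a h) k y) = (iter h T x <= y).
Proof.
move=> kh xk /andP[y0 y1]; rewrite /inv_branch; case: eqP => [->|/eqP yn1].
  have /andP[_ /ltW ->] := iter_node_itv kh xk.
  by have /andP[_ /ltW ->] := xk.
have [] := @iter_node_surj h k y kh; first by rewrite y0 lt_neqAle yn1.
set z := 'pinv_ _ _ _ _ => zk zE.
by rewrite -zE !leNgt (iter_node_lt kh) ?in_itv.
Qed.

(** The minimum defining c_i has at most one term: nodes of T^hi to the left of
    the j-th one have their branch values below a_k, those to its right start
    after a_{k+1}. *)
Lemma c_funE hi hn k j y : (k < 2 ^ hn)%N -> (j < 2 ^ hi)%N ->
    a hi j <= a hn k -> a hn k.+1 <= a hi j.+1 -> 0 <= y <= 1 ->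
  c_fun s a hi hn k y = Num.max (a hn k) (inv_branch s hi (a hi) j y).
Proof.
move=> kh jh ja aj yI; rewrite /c_fun.
set in_set := (X in [pick x | X x]).
have only_j (i : 'I_(2 ^ hi)) : in_set i -> i = j :> nat.
  move=> /andP[kT ik]; have /andP[_ Ti] := inv_branch_itv (ltn_ord i) yI.
  apply/eqP; rewrite eqn_leq; apply/andP; split; rewrite leqNgt; apply/negP => ij.
    have : a hi j.+1 <= a hi i by apply: endpoint_le; rewrite ij ltnW.
    by move=> /(le_trans aj); rewrite leNgt ik.
  have : a hi i.+1 <= a hi j by apply: endpoint_le; rewrite ij ltnW.
  by move=> /(le_trans Ti)/le_trans/(_ ja); rewrite leNgt kT.
have jk : a hi j < a hn k.+1 by rewrite (le_lt_trans ja) ?endpoint_ltS.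
case: pickP => [j0 j0P|none].
  have j0E := only_j _ j0P; rewrite -j0E in jk *.
  have /andP[/ltW kT _] := j0P; rewrite max_r//.
  by elim/big_ind: _ => [//|_ _ -> ->|i /only_j ->]; rewrite ?minxx ?j0E.
have := none (Ordinal jh); rewrite /in_set /= jk andbT => /negbT.
by rewrite -leNgt => Tk; rewrite max_l.
Qed.

Section Times.
Variables (n : nat) (h : 'I_n.+2 -> nat) (y : 'I_n.+2 -> R).
Hypotheses (h_max : forall i, (h i <= h ord_max)%N)
           (yI : forall i, 0 <= y i <= 1).
Let hn := h ord_max.

(** The upper bound comes from the last index, whose branch maps into the k-th
    node itself. *)
Lemma b_fun_itv k : (k < 2 ^ hn)%N -> a hn k <= b_fun s a h k y <= a hn k.+1.
Proof.
move=> kh; have kk := inv_branch_itv kh (yI ord_max); have /andP[k0 k1] := kk.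
have c_max : c_fun s a hn hn k (y ord_max) = inv_branch s hn (a hn) k (y ord_max).
  by rewrite (c_funE kh kh)// max_r.
apply/andP; split.
  have c_ge i : a hn k <= c_fun s a (h i) hn k (y i).
    have [j jh [ja aj]] := node_nested (h_max i) kh.
    by rewrite (c_funE kh jh)// le_max lexx.
  by apply/bigmin_geP; split.
apply: (@le_trans _ _ (c_fun s a hn hn k (y ord_max))); last by rewrite c_max.
exact: (@bigmin_inf _ _ _ _ ord_max).
Qed.

(** The left end point is excluded: c_i is a_k also when the i-th condition fails
    at a_k. *)
Lemma le_b_fun k x : (k < 2 ^ hn)%N -> a hn k < x < a hn k.+1 ->
  (x <= b_fun s a h k y) <-> forall i, i != ord0 -> iter (h i) T x <= y i.
Proof.
move=> kh /andP[kx xk].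
have c_le i : (x <= c_fun s a (h i) hn k (y i)) = (iter (h i) T x <= y i).
  have [j jh [ja aj]] := node_nested (h_max i) kh.
  rewrite (c_funE kh jh)// le_max leNgt kx /= le_inv_branch//.
  by rewrite (le_trans ja) ?ltW// (lt_le_trans xk).
split=> [/bigmin_geP[_ xb] i i0|Tx]; first by rewrite -c_le; exact: xb.
by apply/bigmin_geP; split=> [|i i0]; rewrite c_le Tx.
Qed.

End Times.
End Nodes.

(** * Mass of the orbit conditions, node by node *)

Section OrbitSums.
Variables (R : realType) (s : R) (mu : probability (measurableTypeR R) R).
Hypothesis mu_mp : mp_measure s mu.

Let T := @mp_map R s.
Let F := F0 mu.

Definition orbit_below (I : Type) (D : set I) (h : I -> nat) (y : I -> R) :
  set R := [set x | forall i, D i -> iter (h i) T x <= y i].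

Lemma measurable_orbit_below (I : finType) D (h : I -> nat) y :
  measurable (orbit_below D h y).
Proof.
have -> : orbit_below D h y = \bigcap_(i in D) (iter (h i) T @^-1` `]-oo, y i]).
  apply/seteqP; split=> x xD i Di; first by rewrite /= in_itv/= xD.
  by have := xD i Di; rewrite /= in_itv.
apply: fin_bigcap_measurable => [|i _]; first exact: finite_finset.
by apply: measurable_iter_preimage; exact: measurable_itv.
Qed.

Lemma F0_flat_null x y : F x = F y -> mu `]x, y]%classic = 0%E.
Proof.
move=> Fxy; have [xy|yx] := leP x y; first by rewrite (mu_itvE mu_mp)// -/F Fxy subrr.
by rewrite set_itv_ge ?measure0// bnd_simp -leNgt ltW.
Qed.

Section NodeSums.
Variables (a : nat -> nat -> R) (n : nat).
Hypothesis ha : forall h, node_endpoints s h (a h).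
Variables (h : 'I_n.+2 -> nat) (y : 'I_n.+2 -> R).
Hypotheses (h_max : forall i, (h i <= h ord_max)%N)
           (yI : forall i, 0 <= y i <= 1).
Let hn := h ord_max.
Let b k := b_fun s a h k y.
Let later := [set i : 'I_n.+2 | i != ord0].
Let Q := orbit_below later h y.
Let cut z : set R := `[0, z[%classic `&` Q.
Let Phi z := fine (mu (cut z)).

Let measurable_cut z : measurable (cut z).
Proof.
by apply: measurableI; [exact: measurable_itv|exact: measurable_orbit_below].
Qed.

(** Inside the k-th node the later conditions select the points up to b_k, apart
    from the two points a_k and z. *)
Lemma mass_in_node k z : (k < 2 ^ hn)%N -> a hn k <= z <= a hn k.+1 ->
  Phi z = Phi (a hn k) + (Num.min (F z) (F (b k)) - F (a hn k)).
Proof.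
move=> kh /andP[kz zk]; have /andP[kb bk] := b_fun_itv ha h_max yI kh.
have /andP[a0 _] := endpoint_itv ha (ltnW kh).
have kmin : a hn k <= Num.min z (b k) by rewrite le_min kz.
have -> : Num.min (F z) (F (b k)) = F (Num.min z (b k)).
  case: (leP z (b k)) => [zb|/ltW bz].
    by rewrite min_l// (F0_le mu_mp).
  by rewrite min_r// (F0_le mu_mp).
have pointwise x : x <> a hn k -> x <> z ->
    ((0 <= x < z) /\ Q x <->
     (0 <= x < a hn k) /\ Q x \/ (a hn k < x <= Num.min z (b k))).
  move=> xk xz; split=> [[/andP[x0 xltz] Qx]|].
    have [xa|ax] := ltP x (a hn k); first by left; rewrite x0.
    have kx : a hn k < x by rewrite lt_neqAle ax andbT; apply/eqP => /esym.
    right; rewrite kx le_min (ltW xltz)/=.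
    by apply/(le_b_fun ha h_max yI kh); rewrite ?kx ?(lt_le_trans xltz).
  case=> [[/andP[-> xa] Qx]|]; first by rewrite (lt_le_trans xa).
  rewrite le_min => /andP[kx /andP[xlez xb]].
  have xltz : x < z by rewrite lt_neqAle xlez andbT; apply/eqP.
  rewrite xltz (le_trans a0 (ltW kx)); split=> //.
  by apply/(le_b_fun ha h_max yI kh); rewrite ?kx ?(lt_le_trans xltz).
have split_mu :
    mu (cut z) = (mu (cut (a hn k)) + mu `]a hn k, Num.min z (b k)]%classic)%E.
  transitivity (mu (cut (a hn k) `|` `]a hn k, Num.min z (b k)]%classic)).
    apply: (eq_measure_ae (mu := mu) (N := [set a hn k] `|` [set z])).
    - exact: measurable_cut.
    - by apply: measurableU; [exact: measurable_cut|exact: measurable_itv].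
    - by apply: measurableU; exact: measurable_set1.
    - by apply: null_set_setU => //; exact: (mu_atomless mu_mp).
    - by move=> x /not_orP[xk xz]; exact: pointwise.
  rewrite measureU//; first exact: measurable_cut.
  have disj x : 0 <= x < a hn k -> a hn k < x <= Num.min z (b k) -> False.
    by move=> /andP[_ /lt_trans xk] /andP[/xk]; rewrite ltxx.
  by apply/seteqP; split=> // x [[xk _] kx]; case: (disj x xk kx).
rewrite /Phi split_mu fineD ?fin_num_measure//; last exact: measurable_cut.
by rewrite (mu_itvE mu_mp).
Qed.

Lemma mass_below_node k : (k <= 2 ^ hn)%N ->
  Phi (a hn k) = \sum_(0 <= j < k) (F (b j) - F (a hn j)).
Proof.
elim: k => [_|k IH kh].
  have [a0 _ _] := ha hn.
  by rewrite big_nil /Phi /cut a0 set_itvco0 set0I measure0.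
have /andP[_ bk] := b_fun_itv ha h_max yI kh.
have ak := ltW (endpoint_ltS ha kh).
rewrite (@mass_in_node k) ?ak ?lexx// IH ?(ltnW kh)// big_nat_recr//= min_r//.
exact: (F0_le mu_mp).
Qed.

(** The index n0 is read off from values of F0.  The point z lies in the closure
    of the node of index n0 and has the F0-value u; masses depend on points only
    through their F0-values, so z can stand for F0_inv u.  For u = 1 it is the
    right end point 1 of the last node. *)
Lemma n0_spec u : 0 <= u <= 1 -> exists z,
  [/\ (n0 mu hn (a hn) u < 2 ^ hn)%N, F z = u &
      a hn (n0 mu hn (a hn) u) <= z <= a hn (n0 mu hn (a hn) u).+1].
Proof.
move=> /andP[u0 u1]; have [a0 a1 _] := ha hn.
have pos : (0 < 2 ^ hn)%N by rewrite expn_gt0.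
have [x x01 Fx] : exists2 x, 0 <= x <= 1 & F x = u.
  by apply: (F0_surj mu_mp); rewrite u0.
rewrite /n0; case: eqP => [u_1|/eqP u_1].
  exists 1; rewrite /F (F0_1 mu_mp) u_1 prednK// a1 lexx andbT; split=> //.
  by have /andP[] := endpoint_itv ha (leq_pred (2 ^ hn)).
case: pickP => [k /andP[ku uk]|none].
  exists (Num.max x (a hn k)).
  have kx : x < a hn k.+1.
    by rewrite ltNge; apply: contraTN uk => /(F0_le mu_mp); rewrite -leNgt -/F Fx.
  rewrite ltn_ord le_max lexx orbT ge_max (ltW kx) (ltW (endpoint_ltS ha _))//.
  split=> //; case: (leP (a hn k) x) => // /ltW xk; apply/eqP; rewrite eq_le ku.
  by rewrite -Fx (F0_le mu_mp).
have [k kh uk] : exists2 k, (k < 2 ^ hn)%N & F (a hn k) <= u < F (a hn k.+1).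
  apply: (step_search (v := fun k => F (a hn k))).
    by rewrite a0 /F (F0_0 mu_mp).
  by rewrite a1 /F (F0_1 mu_mp) lt_neqAle u_1.
by have := none (Ordinal kh); rewrite /= uk.
Qed.

(** The point y ord0 is exchanged for the point z of the node n0: the interval
    between them is null because F0 takes the same value at both ends. *)
Lemma mass_formula u0 : 0 <= u0 <= 1 -> F (y ord0) = u0 -> h ord0 = 0%N ->
  let k0 := n0 mu hn (a hn) u0 in
  fine (mu (orbit_below setT h y)) =
    \sum_(0 <= k < k0) (F (b k) - F (a hn k))
    + Num.min u0 (F (b k0)) - F (a hn k0).
Proof.
move=> u0I Fy0 h0 k0; have [z [k0h Fz zk]] := n0_spec u0I.
rewrite -addrA -mass_below_node ?(ltnW k0h)// -[in Num.min u0 _]Fz -mass_in_node//.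
congr fine; have pointwise x : 0 <= x <= 1 -> ~ (y ord0 < x <= z) -> ~ (z < x <= y ord0) ->
    x <> z -> (orbit_below setT h y x <-> (0 <= x < z) /\ Q x).
  move=> /andP[x0 _] /negP n1 /negP n2 xz; split=> [Tx|[/andP[_ xltz] Qx i _]].
    split; last by move=> i _; exact: Tx.
    rewrite x0 /=; have := Tx ord0 I; rewrite h0 /= => xy.
    rewrite ltNge le_eqVlt negb_or; apply/andP; split; first by apply/eqP => /esym.
    by rewrite xy andbT in n2.
  have [->|i0] := eqVneq i ord0; last exact: Qx.
  rewrite h0 /= leNgt; apply/negP => yx.
  by rewrite yx (ltW xltz) in n1.
have mout : measurable (~` `[0, 1]%classic : set (measurableTypeR R)).
  by apply: measurableC; exact: measurable_itv.
have mW : measurable (`]y ord0, z]%classic `|` `]z, y ord0]%classic : set (measurableTypeR R)).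
  by apply: measurableU; exact: measurable_itv.
apply: (eq_measure_ae (mu := mu) (N := ~` `[0, 1]%classic `|`
  (`]y ord0, z]%classic `|` `]z, y ord0]%classic) `|` [set z])).
- exact: measurable_orbit_below.
- exact: measurable_cut.
- by apply: measurableU; [exact: measurableU|exact: measurable_set1].
- apply: null_set_setU; [exact: measurableU|exact: measurable_set1| |].
    apply: null_set_setU => //; first exact: mu_outside mu_mp.
    by apply: null_set_setU; try exact: measurable_itv; apply: F0_flat_null; rewrite Fy0.
  exact: mu_atomless mu_mp _.
- move=> x /not_orP[/not_orP[/contrapT x01 /not_orP[n1 n2]] xz].
  exact: pointwise.
Qed.

End NodeSums.
End OrbitSums.

(** * From the copula to orbit probabilities *)

Lemma measure_bigsetU_le d (T : measurableType d) (R : realType)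
    (mu : {measure set T -> \bar R}) (I : Type) (r : seq I) (B : I -> set T) :
  (forall i, measurable (B i)) ->
  (mu (\big[setU/set0]_(i <- r) B i) <= \sum_(i <- r) mu (B i))%E.
Proof.
move=> mB; elim: r => [|i r IH]; first by rewrite !big_nil measure0.
rewrite !big_cons; apply: (le_trans (measureU2 _ _ _)) => //.
  by apply: bigsetU_measurable.
exact: leeD.
Qed.

(** The level is the supremum of phi over the good points left of x.  It is
    finite because good points exist to the right of x, and it is exceeded
    strictly at any good z > x since there are good points between x and z. *)
Lemma level_set_initial (R : realType) (phi : R -> R) (N : set (measurableTypeR R)) x :
    @lebesgue_measure R N = 0%E -> measurable N ->
    (forall y z, (`[0, 1] `\` N) y -> (`[0, 1] `\` N) z -> y < z ->
      phi y < phi z) ->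
    0 < x < 1 ->
  exists c, forall z, (`[0, 1] `\` N) z -> z <> x -> (phi z <= c <-> z <= x).
Proof.
move=> N0 mN phi_inc /andP[x0 x1].
(* a nonempty open interval is not contained in a null set *)
have pick p q : 0 <= p -> p < q -> q <= 1 ->
    exists2 z, p < z < q & (`[0, 1] `\` N) z.
  move=> p0 pq q1; apply: contrapT => none.
  have sub : `]p, q[%classic `<=` N.
    move=> z; rewrite /= in_itv/= => /andP[pz zq]; apply: contrapT => Nz.
    apply: none; exists z; first by rewrite pz.
    split=> //; rewrite /= in_itv/= (le_trans p0 (ltW pz)).
    by rewrite (le_trans (ltW zq)).
  have : @lebesgue_measure R `]p, q[%classic = 0%E.
    exact: (subset_measure0 (mu := @lebesgue_measure R) (measurable_itv _) mN sub N0).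
  rewrite lebesgue_measure_itv/= lte_fin pq => /eqP.
  by rewrite -EFinB eqe subr_eq0 gt_eqF.
pose S := [set phi z | z in [set z | (`[0, 1] `\` N) z /\ z < x]].
have [z0 /andP[_ z0x] z0I] := pick 0 x (lexx _) x0 (ltW x1).
have S_ub w : (`[0, 1] `\` N) w -> x < w -> ubound S (phi w).
  by move=> wI xw _ [z [zI zx] <-]; rewrite ltW// phi_inc// (lt_trans zx).
have [w /andP[xw _] wI] := pick x 1 (ltW x0) x1 (lexx _).
have S0 : S !=set0 by exists (phi z0); exists z0.
exists (sup S) => z zI zx; split=> [phiz|].
  rewrite leNgt; apply/negP => xz.
  have z1 : z <= 1 by have [+ _] := zI; rewrite /= in_itv/= => /andP[].
  have [z' /andP[xz' z'z] z'I] := pick x z (ltW x0) xz z1.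
  have := phi_inc _ _ z'I zI z'z; rewrite ltNge (le_trans phiz)//.
  by apply: ge_sup => //; exact: S_ub.
rewrite le_eqVlt => /predU1P[//|zltx].
apply: ub_le_sup; first by exists (phi w); exact: S_ub.
by exists z.
Qed.

Section Process.
Variables (R : realType) (s : R) (mu : probability (measurableTypeR R) R).
Variables (phi : R -> R) (d : measure_display) (Omega : measurableType d).
Variables (P : probability Omega R) (U0 : {RV P >-> R}) (X : nat -> {RV P >-> R}).
Hypotheses (hX : mp_process s mu phi U0 X) (phi_inc : ae_increasing phi).

Let T := @mp_map R s.
Let F := F0 mu.

Let mu_mp : mp_measure s mu. Proof. by case: hX. Qed.

Lemma level_set_ray x : 0 < x < 1 ->
  exists c (N : set (measurableTypeR R)), [/\ measurable N, mu N = 0%E &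
    forall z, ~ N z -> (phi z <= c <-> z <= x)].
Proof.
move=> x01; have [N0 [[N [mN lN N0N]] inc]] := phi_inc.
have N_inc y z : (`[0, 1] `\` N) y -> (`[0, 1] `\` N) z -> y < z -> phi y < phi z.
  move=> [y1 yN] [z1 zN]; apply: inc; split=> //.
  - by move=> /N0N.
  - by move=> /N0N.
have [c cP] := level_set_initial lN mN N_inc x01.
have mout : measurable (~` `[0, 1]%classic : set (measurableTypeR R)).
  by apply: measurableC; exact: measurable_itv.
exists c, (~` `[0, 1]%classic `|` N `|` [set x]); split.
- by apply: measurableU; [exact: measurableU|exact: measurable_set1].
- apply: null_set_setU; [exact: measurableU|exact: measurable_set1| |].
    apply: null_set_setU => //; first exact: mu_outside mu_mp.
    exact: lebesgue_null_mu mu_mp _ _ _.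
  exact: mu_atomless mu_mp _.
- by move=> z /not_orP[/not_orP[/contrapT z01 zN] zx]; apply: cP.
Qed.

(** Almost surely no orbit point T^(t i) U0 falls in the exceptional set N i,
    because each preimage of N i is null by invariance. *)
Lemma joint_law m (t : 'I_m -> nat) (x c : 'I_m -> R)
    (N : 'I_m -> set (measurableTypeR R)) :
    (forall i, measurable (N i)) -> (forall i, mu (N i) = 0%E) ->
    (forall i z, ~ N i z -> (phi z <= c i <-> z <= x i)) ->
  P [set w | forall i, X (t i) w <= c i] = mu (orbit_below s setT t x).
Proof.
move=> mN N0 NP; have [_ lawU _ XE] := hX.
have mU (A : set (measurableTypeR R)) : measurable A -> measurable (U0 @^-1` A).
  by move=> mA; rewrite -[X in measurable X]setTI; exact: measurable_funP.
pose M : set (measurableTypeR R) := \big[setU/set0]_i (iter (t i) T @^-1` N i).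
have mM : measurable M.
  by apply: bigsetU_measurable => i _; exact: measurable_iter_preimage.
have M0 : mu M = 0%E.
  apply/eqP; rewrite -measure_le0 (le_trans (measure_bigsetU_le _ _ _))//.
    by move=> i; exact: measurable_iter_preimage.
  by rewrite big1// => i _; exact: etrans (mu_iter mu_mp _ (mN i)) (N0 i).
have mZ : measurable (orbit_below s setT t x : set (measurableTypeR R)).
  exact: measurable_orbit_below.
rewrite -[RHS]lawU//.
apply: (eq_measure_ae (mu := P) (N := U0 @^-1` M)).
- have -> : [set w | forall i, X (t i) w <= c i] =
      \bigcap_(i in setT) (X (t i) @^-1` `]-oo, c i]).
    apply/seteqP; split=> w wX i; first by move=> _; rewrite /= in_itv/= wX.
    by have := wX i I; rewrite /= in_itv.
  apply: fin_bigcap_measurable => [|i _]; first exact: finite_finset.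
  by rewrite -[X in measurable X]setTI; exact: measurable_funP.
- exact: mU.
- exact: mU.
- exact: etrans (lawU _ mM) M0.
- move=> w Mw; have wN i : ~ N i (iter (t i) T (U0 w)).
    by move=> Ni; apply: Mw; rewrite /= /M (bigD1 i)//=; left.
  split=> wX i; first by move=> _; apply/(NP i _ (wN i)); rewrite -XE.
  by rewrite XE; apply/(NP i _ (wN i)); exact: wX.
Qed.

Lemma law_single t x : mu (orbit_below s [set: 'I_1] (fun=> t) (fun=> x)) = (F x)%:E.
Proof.
rewrite -(mu_rayE mu_mp) -[RHS](mu_iter mu_mp t); last exact: measurable_itv.
congr (mu _); apply/seteqP; split=> z zx; first by rewrite /= in_itv/= (zx ord0).
by move=> i _; move: zx; rewrite /= in_itv.
Qed.

Section CopulaLaw.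
Variables (m : nat) (t : 'I_m -> nat) (C : ('I_m -> R) -> R).
Hypothesis hC : copula_of (fun i => X (t i)) C.

Let G (u : 'I_m -> R) :=
  fine (mu (orbit_below s setT t (fun i => F0_inv mu (u i)))).

(** Levels c i of the variables are chosen so that the marginal distribution
    functions take the values u i; the marginals are instances of the joint law
    for a single time. *)
Lemma copula_law_interior u : (forall i, 0 < u i < 1) -> C u = G u.
Proof.
move=> uI; have [_ sklar] := hC; pose x i := F0_inv mu (u i).
have Fx i : F (x i) = u i.
  by have /andP[/ltW u0 /ltW u1] := uI i; case: (F0_invK mu_mp (introT andP (conj u0 u1))).
have xI i : 0 < x i < 1.
  have /andP[u0 u1] := uI i; apply/andP; split.
    rewrite ltNge; apply: contraTN u0 => /(F0_le mu_mp).
    by rewrite -/F Fx /F (F0_0 mu_mp) leNgt.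
  rewrite ltNge; apply: contraTN u1 => /(F0_le mu_mp).
  by rewrite -/F Fx /F (F0_1 mu_mp) leNgt.
have /choice[c cP] i := level_set_ray (xI i).
have /choice[N NP] := cP.
have mN i : measurable (N i) by case: (NP i).
have N0 i : mu (N i) = 0%E by case: (NP i).
have Nc i z : ~ N i z -> (phi z <= c i <-> z <= x i) by case: (NP i) => _ _; apply.
have uE : u = fun i => fine (cdf (X (t i)) (c i)).
  apply/funext => i.
  suff -> : cdf (X (t i)) (c i) = (F (x i))%:E by rewrite Fx.
  rewrite -(law_single (t i)).
  rewrite -(@joint_law 1 (fun=> t i) (fun=> x i) (fun=> c i) (fun=> N i))//.
  - congr (P _); apply/seteqP; split=> w wX; last by have := wX ord0; rewrite /= in_itv.
    by move=> _; move: wX; rewrite /= in_itv.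
  - by move=> _; exact: Nc.
by rewrite [in LHS]uE -sklar (joint_law t mN N0 Nc).
Qed.

(** The set for u exceeds the set for v by orbits that enter some interval
    ]F0_inv (v i), F0_inv (u i)] at time t i, an event of mass u i - v i. *)
Lemma copula_law_lipschitz u v : (forall i, 0 <= u i <= 1) ->
  (forall i, 0 <= v i <= u i) -> 0 <= G u - G v <= \sum_i (u i - v i).
Proof.
move=> uI vu; pose x i := F0_inv mu (u i); pose y i := F0_inv mu (v i).
have vI i : 0 <= v i <= 1.
  have /andP[v0 vui] := vu i; have /andP[_ u1] := uI i.
  by rewrite v0 (le_trans vui).
have Fx i : F (x i) = u i by case: (F0_invK mu_mp (uI i)).
have Fy i : F (y i) = v i by case: (F0_invK mu_mp (vI i)).
have yx i : y i <= x i.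
  have /andP[_] := vu i; rewrite le_eqVlt => /predU1P[|vltu].
    by rewrite /x /y => ->.
  by rewrite ltW// ltNge; apply: contraTN vltu => /(F0_le mu_mp);
    rewrite -/F Fx Fy leNgt.
pose B i : set (measurableTypeR R) := iter (t i) T @^-1` `]y i, x i]%classic.
have mB i : measurable (B i).
  by apply: measurable_iter_preimage; exact: measurable_itv.
have mG z : measurable (orbit_below s setT t z : set (measurableTypeR R)).
  exact: measurable_orbit_below.
have muB i : mu (B i) = (u i - v i)%:E.
  by rewrite (mu_iter mu_mp); [rewrite (mu_itvE mu_mp)// -/F Fx Fy|exact: measurable_itv].
have mUB : measurable (\big[setU/set0]_i B i) by apply: bigsetU_measurable.
apply/andP; split.
  rewrite subr_ge0; apply: fine_le; rewrite ?fin_num_measure//; try exact: mG.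
  apply: le_measure; rewrite ?inE; try exact: mG.
  by move=> z zy i _; rewrite (le_trans (zy i I))//; exact: yx.
rewrite lerBlDl -lee_fin EFinD !fineK ?fin_num_measure//.
rewrite -sumEFin; under eq_bigr do rewrite -muB.
apply: le_trans (leeD (lexx _) (measure_bigsetU_le mu _ mB)).
apply: (le_trans _ (measureU2 _ _ _)) => //.
apply: le_measure; rewrite ?inE//; first exact: measurableU.
move=> z zx.
have [zy|/existsNP[i zi]] := pselect (forall i, iter (t i) T z <= y i).
  by left=> i _.
right; rewrite (bigD1 i)//=; left; rewrite /B /= in_itv/= (zx i I) andbT.
by rewrite ltNge; apply/negP.
Qed.

(** Coordinates equal to 1 are replaced by 1 - e; both sides move by at most
    m * e. *)
Lemma copula_law u : (forall i, 0 <= u i <= 1) -> C u = G u.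
Proof.
move=> uI; have [copC _] := hC; have [grd _ _] := copC.
have [[i ui0]|no0] := pselect (exists i, u i = 0).
  rewrite (grd _ _ uI ui0); apply/esym/eqP; rewrite eq_le fine_ge0// andbT.
  have mB : measurable (iter (t i) T @^-1` `]-oo, F0_inv mu (u i)] :
    set (measurableTypeR R)).
    by apply: measurable_iter_preimage; exact: measurable_itv.
  have -> : 0 = fine (mu (iter (t i) T @^-1` `]-oo, F0_inv mu (u i)])).
    rewrite (mu_iter mu_mp); last exact: measurable_itv.
    by rewrite (mu_rayE mu_mp); case: (F0_invK mu_mp (uI i)) => _ ->.
  rewrite fine_le ?fin_num_measure//; try exact: measurable_orbit_below.
  apply: le_measure; rewrite ?inE//; first exact: measurable_orbit_below.
  by move=> z zx; rewrite /= in_itv/= zx.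
have upos i : 0 < u i.
  have /andP[u0 _] := uI i; rewrite lt_neqAle u0 andbT eq_sym.
  by apply/eqP => ui0; apply: no0; exists i.
have close e : 0 < e < 1 -> `|C u - G u| <= m%:R * e.
  move=> /andP[e0 e1]; pose v i := Num.min (u i) (1 - e).
  have vI i : 0 < v i < 1.
    by rewrite lt_min upos subr_gt0 e1 gt_min [1 - e < 1]ltrBlDr ltrDl e0 orbT.
  have vu i : 0 <= v i <= u i.
    by have /andP[/ltW-> _] := vI i; rewrite ge_min lexx.
  have lipC := copula_lipschitz copC uI vu.
  have lipG := copula_law_lipschitz uI vu.
  have small : \sum_i (u i - v i) <= m%:R * e.
    rewrite -[m in leRHS]card_ord mulr_natl -sumr_const; apply: ler_sum => i _.
    have /andP[_ u1] := uI i; rewrite /v; case: (leP (u i) (1 - e)) => _; lra.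
  have := copula_law_interior vI => CG; rewrite CG in lipC.
  move: lipC lipG => /andP[p q] /andP[p' q'].
  rewrite ler_norml; apply/andP; split; lra.
apply/eqP; rewrite -subr_eq0 -normr_le0; apply/ler_addgt0Pr => e e0.
(* division by m + 1 rather than m covers the empty family as well *)
rewrite add0r; pose f := Num.min 2^-1 (e / (m.+1)%:R).
have f01 : 0 < f < 1.
  rewrite lt_min invr_gt0 ltr0n divr_gt0//= gt_min invf_lt1 ?ltr0n//.
  by rewrite ltr1n.
apply: (le_trans (close f f01)).
apply: (@le_trans _ _ ((m.+1)%:R * (e / (m.+1)%:R))).
  apply: ler_pM => //; rewrite ?ler_nat//; first by case/andP: f01 => /ltW.
  by rewrite ge_min lexx orbT.
by rewrite mulrCA divff ?mulr1.
Qed.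

Lemma copula_law_shift (k : nat) (u : 'I_m -> R) :
  (forall i, 0 <= u i <= 1) -> (forall i, (k <= t i)%N) ->
  C u = fine (mu (orbit_below s setT (fun i => (t i - k)%N)
    (fun i => F0_inv mu (u i)))).
Proof.
move=> uI kt; rewrite copula_law// /G; congr fine.
rewrite -[RHS](mu_iter mu_mp k); last exact: measurable_orbit_below.
congr (mu _); apply/seteqP; split=> z zx i _; have := zx i I;
  by rewrite /= -iterD subnK.
Qed.

End CopulaLaw.
End Process.

Theorem theorem4p1 (R : realType) (s : R) (hs : 0 < s < 1)
    (mu : probability (measurableTypeR R) R) (phi : R -> R)
    (d : measure_display) (Omega : measurableType d) (P : probability Omega R)
    (U0 : {RV P >-> R}) (X : nat -> {RV P >-> R})
    (hX : mp_process s mu phi U0 X) (hphi : ae_increasing phi)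
    (a : nat -> nat -> R) (ha : forall h : nat, node_endpoints s h (a h))
    (n : nat) (t : 'I_n.+2 -> nat)
    (ht : forall i : 'I_n.+2, (t ord0 <= t i <= t ord_max)%N)
    (C : ('I_n.+2 -> R) -> R) (hC : copula_of (fun i => X (t i)) C)
    (u : 'I_n.+2 -> R) (hu : forall i : 'I_n.+2, 0 <= u i <= 1) :
  let h := fun i : 'I_n.+2 => (t i - t ord0)%N in
  let hn := h ord_max in
  let k0 := n0 mu hn (a hn) (u ord0) in
  let b := fun k : nat => b_fun s a h k (fun i => F0_inv mu (u i)) in
  C u =
    (\sum_(0 <= k < k0) (F0 mu (b k) - F0 mu (a hn k))) * (0 < k0)%N%:R
    + Num.min (u ord0) (F0 mu (b k0)) - F0 mu (a hn k0).
Proof.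
move=> h hn k0 b; have [mu_mp _ _ _] := hX.
have h_max i : (h i <= h ord_max)%N.
  by rewrite /h leq_sub2r//; case/andP: (ht i).
have xI i : 0 <= F0_inv mu (u i) <= 1 by case: (F0_invK mu_mp (hu i)).
have Fx0 : F0 mu (F0_inv mu (u ord0)) = u ord0.
  by case: (F0_invK mu_mp (hu ord0)).
have h0 : h ord0 = 0%N by rewrite /h subnn.
have t0 i : (t ord0 <= t i)%N by case/andP: (ht i).
rewrite (copula_law_shift hX hphi hC hu t0).
rewrite (mass_formula mu_mp ha h_max xI (hu ord0) Fx0 h0).
congr (_ + _ - _); rewrite -/hn -/k0.
by case: (k0) => [|k]; rewrite ?mulr1// big_nil mul0r.
Qed.
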